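(* Let $n\ge 2$. For every linearly ordered factorization $u\in U_n$ of the $n$-cycle $(1,2,\dots,n)$, $$\mathrm{Des}(\phi(u))=\mathrm{Des}(u).$$
   Context: Notation: $[m]=\{1,\dots,m\}$; products of permutations are composed from right to left. A factorization of the $n$-cycle $(1,2,\dots,n)$ (i.e. $1\mapsto 2\mapsto\cdots\mapsto n\mapsto 1$) is a sequence $w=(t_1,\dots,t_{n-1})$ of transpositions in $\mathfrak{S}_n$ with $t_1\cdots t_{n-1}=(1,2,\dots,n)$; $F_n$ is the set of all of these. A factorization is linearly ordered if for every $1\le i\le n-2$, $t_i$ and $t_{i+1}$ have a common letter; $U_n\subseteq F_n$ is the set of linearly ordered factorizations. For $u=(t_1,\dots,t_{n-1})\in U_n$, the descent set is $$\mathrm{Des}(u)=\{i\in[n-2]: t_i=(b,c)\text{ and }t_{i+1}=(b,a)\text{ with }c>a\},$$ where $b$ is the common letter of $t_i$ and $t_{i+1}$ and the comparison $c>a$ is in the usual order on integers. The map $\phi:F_n\to\mathfrak{S}_{n-1}$: for $w=(t_1,\dots,t_{n-1})\in F_n$ put $\sigma_j=t_jt_{j+1}\cdots t_{n-1}$ for $1\le j\le n-1$ and $\sigma_n=\mathrm{id}$. For $1\le j\le n-1$ let $A_j=\{\,1\le i\le n-1:\sigma_j(i)>\sigma_{j+1}(i)\,\}$. It is known that each $A_j$ has exactly one element and that $\phi(w)$, defined by letting $\phi(w)(j)$ be the unique element of $A_j$, is a permutation in $\mathfrak{S}_{n-1}$. For $\pi\in\mathfrak{S}_{n-1}$, $\mathrm{Des}(\pi)=\{i\in[n-2]:\pi(i)>\pi(i+1)\}$.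 *)

(* Defs.v *)
(** Linearly ordered factorizations of the [n]-cycle, over MathComp. *)
From mathcomp Require Import all_boot all_fingroup.

Set Implicit Arguments.
Unset Strict Implicit.
Unset Printing Implicit Defensive.

(** Index conventions.  Everything is shifted by one: the letters [1..n] are
    the elements [0..n-1] of ['I_n], the positions [1..n-1] of a factorization
    are those of ['I_n.-1], and [[n-2]] is ['I_n.-2].  An [i : 'I_m.-1] has two
    neighbouring images in ['I_m], of values [i] and [i.+1]. *)
Lemma ord_hi_subproof m (i : 'I_m.-1) : i.+1 < m.
Proof. by case: m i => [|m] i; [case: i | rewrite ltnS]. Qed.

Definition ord_lo m (i : 'I_m.-1) : 'I_m := widen_ord (leq_pred m) i.
Definition ord_hi m (i : 'I_m.-1) : 'I_m := Ordinal (ord_hi_subproof i).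

(** The [n]-cycle [(1,2,...,n)]: [ordS i] has value [i.+1 %% n]. *)
Definition ncycle n : 'S_n := perm (@ordS_inj n).

Definition transposition n (t : 'S_n) : bool :=
  [exists a, exists b, (a != b) && (t == tperm a b)].

(** The product [t_1 ... t_k] composed from right to left.  MathComp's product
    of permutations composes from left to right ([permM]), whence [p * t]. *)
Definition rl_prod n (s : seq 'S_n) : 'S_n := foldr (fun t p => (p * t)%g) 1%g s.

Definition F n : {set (n.-1).-tuple 'S_n} :=
  [set w : (n.-1).-tuple _ | all (@transposition n) w && (rl_prod w == ncycle n)].

Definition common_letter n (t t' : 'S_n) : bool :=
  [exists b, (t b != b) && (t' b != b)].

Definition linearly_ordered n (w : (n.-1).-tuple 'S_n) : bool :=
  [forall i : 'I_n.-2, common_letter (tnth w (ord_lo i)) (tnth w (ord_hi i))].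

Definition U n : {set (n.-1).-tuple 'S_n} := [set u in F n | linearly_ordered u].

Lemma U_sub_F n (u : (n.-1).-tuple 'S_n) : u \in U n -> u \in F n.
Proof. by rewrite inE => /andP[]. Qed.

Definition DesU n (u : (n.-1).-tuple 'S_n) : {set 'I_n.-2} :=
  [set i | [exists a, exists b, exists c : 'I_n,
     [&& tnth u (ord_lo i) == tperm b c,
         tnth u (ord_hi i) == tperm b a & a < c]]].

Definition DesS m (p : 'S_m) : {set 'I_m.-1} :=
  [set i | p (ord_hi i) < p (ord_lo i)].

(** With [j] counted from [0], [sigma w j] is [t_{j+1} ... t_{n-1}]. *)
Definition sigma n (w : (n.-1).-tuple 'S_n) (j : nat) : 'S_n :=
  rl_prod (drop j w).

Definition A n (w : (n.-1).-tuple 'S_n) (j : 'I_n.-1) : {set 'I_n.-1} :=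
  [set i | sigma w j.+1 (ord_lo i) < sigma w j (ord_lo i)].

(** The element of [A w j] when it is unique, which is so for [w \in F n]
    ([phiE] below); the default [j] is then never used. *)
Definition phi_fun n (w : (n.-1).-tuple 'S_n) (j : 'I_n.-1) : 'I_n.-1 :=
  odflt j [pick i in A w j].

Lemma sigma_rec n (w : (n.-1).-tuple 'S_n) (j : 'I_n.-1) :
  sigma w j = (sigma w j.+1 * tnth w j)%g.
Proof.
by rewrite /sigma (drop_nth 1%g) ?size_tuple //= (tnth_nth 1%g).
Qed.

Lemma A_uniq n (w : (n.-1).-tuple 'S_n) j i i' :
  w \in F n -> i \in A w j -> i' \in A w j -> i = i'.
Proof.
rewrite inE => /andP[/allP tw _]; rewrite !inE sigma_rec !permM.
have /existsP[a /existsP[b /andP[_ /eqP->]]] := tw _ (mem_tnth j w).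
have up (x y : 'I_n) : x < tperm a b x -> y < tperm a b y -> x = y.
  case: tpermP => [->|->|_ _]; last by rewrite ltnn.
  - by move=> ab; case: tpermP => [->//|->|_ _]; rewrite ?ltnn // ltnNge ltnW.
  - by move=> ab; case: tpermP => [->|->//|_ _]; rewrite ?ltnn // ltnNge ltnW.
move=> hi hi'; have /perm_inj e := up _ _ hi hi'.
by apply: val_inj; rewrite -[val i]/(val (ord_lo i)) e.
Qed.

Lemma A_cover n (w : (n.-1).-tuple 'S_n) i :
  w \in F n -> exists j, i \in A w j.
Proof.
rewrite inE => /andP[_ /eqP w_c]; apply/existsP; apply: contraT.
rewrite negb_exists => /forallP noA.
have le k : k <= n.-1 -> sigma w 0 (ord_lo i) <= sigma w k (ord_lo i).
  elim: k => // k IHk lt_k; apply: leq_trans (IHk (ltnW lt_k)) _.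
  by have := noA (Ordinal lt_k); rewrite inE -leqNgt.
have := le _ (leqnn _).
rewrite {1}/sigma drop0 w_c permE /sigma drop_oversize ?size_tuple // perm1 /=.
by rewrite modn_small ?ltnn // ord_hi_subproof.
Qed.

Lemma phi_funE n (w : (n.-1).-tuple 'S_n) (hw : w \in F n) i j :
  i \in A w j -> phi_fun w j = i.
Proof.
rewrite /phi_fun; case: pickP => [i' Ai' Ai|/(_ i)->//].
exact: A_uniq hw Ai' Ai.
Qed.

Lemma phi_fun_bij n (w : (n.-1).-tuple 'S_n) (hw : w \in F n) :
  exists2 h, cancel h (phi_fun w) & (forall i, i \in A w (h i)) /\ cancel (phi_fun w) h.
Proof.
pose h i := xchoose (A_cover i hw).
have Ah i : i \in A w (h i) := xchooseP (A_cover i hw).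
have hK : cancel h (phi_fun w) by move=> i; apply: phi_funE.
exists h => //; split=> // j.
by have [g gK Kg] := injF_bij (can_inj hK); rewrite -(Kg j) hK.
Qed.

Lemma phi_inj n (w : (n.-1).-tuple 'S_n) : w \in F n -> injective (phi_fun w).
Proof. by move=> /phi_fun_bij[h _ [_ /can_inj]]. Qed.

Definition phi n (w : (n.-1).-tuple 'S_n) (hw : w \in F n) : 'S_(n.-1) :=
  perm (phi_inj hw).

Lemma phiE n (w : (n.-1).-tuple 'S_n) (hw : w \in F n) j :
  A w j = [set phi hw j].
Proof.
have [h hK [Ah Kh]] := phi_fun_bij hw.
apply/setP=> i; rewrite in_set1 permE; apply/idP/eqP => [/(phi_funE hw)->//|->].
by have := Ah (phi_fun w j); rewrite Kh.
Qed.

(* Main.v *)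
Require Import Defs.
From mathcomp Require Import all_boot all_fingroup.
From mathcomp Require Import zify.

(** Read the product from right to left as a motion of the letters: at time
    [k], the letter [i] sits at [sigma w k i], and [k] decreases from [n.-1]
    (identity) to [0] (the [n]-cycle).  Each letter [i] other than the largest
    must get from [i] to [i.+1], and it rises at exactly one step, the [j] with
    [phi hw j = i]; elsewhere it stays or falls.  Hence it sits at or below [i]
    until that step and strictly above [i] from then on: position and time are
    tied by [excedance_phi].

    For two consecutive transpositions [(b,a)], acting first, and [(b,c)], let
    [P] and [Q] be the letters that they raise.  The inequalities that
    [excedance_phi] gives for [P] and [Q] around these two steps are already
    enough to compare [P] with [Q] ([riser_ltE]): in each possible relative
    order of [a], [b], [c], one of these three letters separates [P] from [Q],
    on the sides dictated by the order of [a] and [c]; in the other orders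
    (among them [a = c]) the inequalities contradict one another. *)

(** The letter [phi hw j] exceeds its own value exactly once it has risen:
    before that it has only gone down from its start [phi hw j], and after that
    it only goes down towards its end [(phi hw j).+1]. *)
Lemma excedance_phi {n} {w : (n.-1).-tuple 'S_n} (hw : w \in F n)
    (j : 'I_n.-1) k :
  k <= n.-1 -> (phi hw j < sigma w k (ord_lo (phi hw j))) = (k <= j).
Proof.
set i := phi hw j => le_k.
have stay (k' : 'I_n.-1) : k' != j ->
    sigma w k' (ord_lo i) <= sigma w k'.+1 (ord_lo i).
  move=> k'j; have: i \notin A w k'.
    by rewrite (phiE hw) in_set1 (inj_eq perm_inj) eq_sym.
  by rewrite inE -leqNgt.
have [le_kj|lt_jk] := leqP k j.
- have final : sigma w 0 (ord_lo i) = i.+1 :> nat.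
    have := hw; rewrite inE /sigma drop0 => /andP[_ /eqP->].
    by rewrite permE /= modn_small // ord_hi_subproof.
  apply/idP; rewrite -final.
  elim: k le_kj le_k => // k IHk lt_kj lt_k.
  apply: leq_trans (IHk (ltnW lt_kj) (ltnW lt_k)) _.
  by apply: (stay (Ordinal lt_k)); rewrite -val_eqE /= ltn_eqF.
- apply/negbTE; rewrite -leqNgt.
  have initial : sigma w n.-1 (ord_lo i) = i :> nat.
    by rewrite /sigma drop_oversize ?size_tuple // perm1.
  (* Induction on the number [n.-1 - k] of steps already performed. *)
  rewrite -[X in _ <= X]initial.
  move: (n.-1 - k) (subnKC le_k) => m.
  elim: m k {le_k} lt_jk => [|m IHm] k lt_jk def_k.
    by rewrite -def_k addn0.
  have lt_k : k < n.-1 by rewrite -def_k addnS ltnS leq_addr.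
  apply: leq_trans (stay (Ordinal lt_k) _) _.
    by rewrite -val_eqE /= gtn_eqF.
  by apply: IHm; rewrite ?addSnnS // ltnW.
Qed.

(** Here [x] and [y] are the positions, before [tperm b a] and then [tperm b c]
    act, of the letters [P] and [Q] that these two transpositions raise.  The
    surviving orders of [a], [b], [c] are [a < c < b], where
    [P < c <= Q], [b < a < c], where [P < a <= Q], and [c < b < a], where
    [Q < b <= P].  In the reverse cyclic order, and when [a = c], one letter
    would be raised twice, or would end at or below its own value. *)
Lemma riser_ltE n (a b c x y : 'I_n) (P Q : nat) :
    (x == y) = (P == Q) ->
    x <= P -> P < tperm b a x -> P < tperm b c (tperm b a x) ->
    y <= Q -> tperm b a y <= Q -> Q < tperm b c (tperm b a y) ->
  (P < Q) = (a < c).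
Proof.
have ne (z t : 'I_n) : z <> t -> z <> t :> nat by move=> zt /val_inj.
rewrite -val_eqE /= => xy_PQ.
case: (tpermP b a x) => [/(congr1 val)/= ?|/(congr1 val)/= ?|/ne ? /ne ?];
  case: (tpermP b a y) => [/(congr1 val)/= ?|/(congr1 val)/= ?|/ne ? /ne ?];
  do 2?case: (tpermP b c) => [/(congr1 val)/= ?|/(congr1 val)/= ?|/ne ? /ne ?];
  lia.
Qed.

Lemma transpositionE {n} {t : 'S_n} {b} :
  transposition t -> t b != b -> t = tperm b (t b).
Proof.
move=> /existsP[x /existsP[y /andP[_ /eqP->]]].
by case: tpermP => [->|->|_ _]; rewrite ?eqxx // => _; rewrite tpermC.
Qed.

(** The order of [a] and [c] is read off from [phi] for every choice of the
    names [a], [b], [c], so that in the definition of [DesU] any common letter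
    can serve as the witness [b]. *)
Lemma phi_ltE {n} {w : (n.-1).-tuple 'S_n} (hw : w \in F n) {i : 'I_n.-2}
    {a b c : 'I_n} :
    tnth w (ord_lo i) = tperm b c -> tnth w (ord_hi i) = tperm b a ->
  (phi hw (ord_hi i) < phi hw (ord_lo i)) = (a < c).
Proof.
move=> t_lo t_hi; have lt_hi := ltn_ord (ord_hi i).
have s1E z : sigma w i.+1 z = tperm b a (sigma w i.+2 z).
  by rewrite (sigma_rec w (ord_hi i)) permM t_hi.
have s0E z : sigma w i z = tperm b c (tperm b a (sigma w i.+2 z)).
  by rewrite (sigma_rec w (ord_lo i)) permM t_lo s1E.
have exP k := excedance_phi hw (ord_hi i) k.
have exQ k := excedance_phi hw (ord_lo i) k.
apply: (@riser_ltE _ a b c (sigma w i.+2 (ord_lo (phi hw (ord_hi i))))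
                           (sigma w i.+2 (ord_lo (phi hw (ord_lo i))))).
- by rewrite (inj_eq perm_inj).
- by rewrite leqNgt exP //= ltnn.
- by rewrite -s1E exP //= ltnW.
- by rewrite -s0E exP //= ltnW // ltnW.
- by rewrite leqNgt exQ //= ltnNge leqnSn.
- by rewrite -s1E leqNgt exQ /= ?ltnn // ltnW.
- by rewrite -s0E exQ //= ltnW // ltnW.
Qed.

Theorem lemma1p10 (n : nat) (hn : 2 <= n) (u : (n.-1).-tuple 'S_n)
  (hu : u \in U n) :
  DesS (phi (U_sub_F hu)) = DesU u.
Proof.
have := hu; rewrite inE => /andP[uF /forallP lin].
have := uF; rewrite inE => /andP[/allP tr _].
apply/setP=> i; rewrite !inE; apply/idP/existsP; last first.
  move=> [a /existsP[b /existsP[c /and3P[/eqP t_lo /eqP t_hi lt_ac]]]].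
  by rewrite (phi_ltE _ t_lo t_hi).
have /existsP[b /andP[lo_b hi_b]] := lin i.
have t_lo := transpositionE (tr _ (mem_tnth _ u)) lo_b.
have t_hi := transpositionE (tr _ (mem_tnth _ u)) hi_b.
rewrite (phi_ltE _ t_lo t_hi) => lt_ac.
exists (tnth u (ord_hi i) b); apply/existsP; exists b; apply/existsP.
by exists (tnth u (ord_lo i) b); rewrite -t_lo -t_hi !eqxx.
Qed.
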